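(* Let $K\subset\mathbb{H}^2$ be a convex body of constant width $w$, containing the origin $O$ in its interior, and such that $\partial K$ is a $C^1$-smooth curve. If the projections $P_\Gamma(K)$ of $K$ on all geodesics $\Gamma$ passing through $O$ have the same length, then $K$ is a disc.
   Context: $\mathbb{H}^2$ is the hyperbolic plane and $O\in\mathbb{H}^2$ is a fixed point, called the origin (e.g. the center of the Poincaré disc model). A body is a compact set $K\subset\mathbb{H}^2$ equal to the closure of its non-empty interior. It is convex if its boundary cannot be intersected by a geodesic in more than two points (with the exception that an arc of a geodesic may be part of the boundary). A supporting geodesic of $K$ is a geodesic that has only one common point with $\partial K$, or has a complete arc in common with $\partial K$. A disc is a closed hyperbolic metric ball of positive radius (not assumed in advance to be centered at $O$). For a geodesic (line) $\Gamma$ and a point $x\in\mathbb{H}^2$, $n_\Gamma(x)$ denotes the geodesic through $x$ perpendicular to $\Gamma$. The projection of $K$ onto $\Gamma$ is $P_\Gamma(K)=\{x\in\Gamma : K\cap n_\Gamma(x)\neq\emptyset\}$, a geodesic segment, and its length is its hyperbolic length. Width: for $K$ with $C^1$-smooth boundary and $x\in\partial K$, $n_K(x)$ denotes the geodesic through $x$ perpendicular to the supporting geodesic of $K$ at $x$. Let $\Gamma_2$ be the other supporting geodesic of $K$ (different from the one at $x$) that is orthogonal to $n_K(x)$, and let $\phi(x)$ be the intersection point of $n_K(x)$ and $\Gamma_2$. The width of $K$ at $x$ is $w_K(x)=\big|[x,\phi(x)]\big|$, the hyperbolic length of the geodesic segment $[x,\phi(x)]$. $K$ has constant width $w$ if $w_K(x)=w$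 for all $x\in\partial K$. *)

(* Defs.v *)
From HB Require Import structures.
From mathcomp Require Import all_boot all_order all_algebra.
From mathcomp Require Import all_classical all_reals all_analysis.
From mathcomp Require Import ring lra.
Import Order.TTheory GRing.Theory Num.Theory.
Import numFieldNormedType.Exports.

Set Implicit Arguments.
Unset Strict Implicit.
Unset Printing Implicit Defensive.

Local Open Scope classical_set_scope.
Local Open Scope ring_scope.

(* Hyperboloid model.  The hyperbolic plane is the sheet <u, u> = -1, 0 < u_3
   of the hyperboloid in Minkowski space R^{2,1}.  This sheet is the graph of
   the smooth function (x, y) |-> sqrt (1 + x^2 + y^2), so that its points are
   represented by (x, y) in R * R, and [hlift] recovers the point of R^{2,1}
   (see [hyperboloidP]).  The projection (x, y) is a global C^oo chart:
   the topology and the differentiable structure of the hyperbolic plane are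
   those of R * R. *)
Notation hplane R := (Real.sort R * Real.sort R)%type (only parsing).
Notation minkowski R :=
  (Real.sort R * Real.sort R * Real.sort R)%type (only parsing).

Definition lor (R : realType) (u v : minkowski R) : R :=
  u.1.1 * v.1.1 + u.1.2 * v.1.2 - u.2 * v.2.

Definition hlift (R : realType) (p : hplane R) : minkowski R :=
  (p.1, p.2, Num.sqrt (1 + p.1 ^+ 2 + p.2 ^+ 2)).

Lemma hyperboloidP (R : realType) (u : minkowski R) :
  (lor u u = -1 /\ 0 < u.2) <-> exists p : hplane R, u = hlift p.
Proof.
have pos (x y : R) : 0 < 1 + x ^+ 2 + y ^+ 2.
  by have := sqr_ge0 x; have := sqr_ge0 y; lra.
split=> [[uu u_gt0]|[[x y] ->]].
- exists u.1; case: u uu u_gt0 => [[x y] z]; rewrite /lor /hlift /= => uu z_gt0.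
  have -> : 1 + x ^+ 2 + y ^+ 2 = z ^+ 2 by rewrite !expr2; lra.
  by rewrite sqrtr_sqr gtr0_norm.
- rewrite /lor /hlift /= -[Num.sqrt _ * _]expr2 sqr_sqrtr ?sqrtr_gt0 ?(ltW (pos _ _)) //.
  by split; [ring | exact: pos].
Qed.

Definition arcosh (R : realType) (t : R) : R := ln (t + Num.sqrt (t ^+ 2 - 1)).

Definition hdist (R : realType) (p q : hplane R) : R :=
  arcosh (- lor (hlift p) (hlift q)).

Definition unit_tangent (R : realType) (p : hplane R) (v : minkowski R) : Prop :=
  lor (hlift p) v = 0 /\ lor v v = 1.

(* The geodesic through p with unit tangent vector v at p: the intersection of
   the hyperboloid with the linear plane spanned by p and v. *)
Definition geodesic_from (R : realType) (p : hplane R) (v : minkowski R) :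
    set (hplane R) :=
  [set q | exists a b : R, hlift q = a *: hlift p + b *: v].

Definition geodesic (R : realType) (G : set (hplane R)) : Prop :=
  exists p v, unit_tangent p v /\ G = geodesic_from p v.

(* The Lorentz form restricted to the tangent plane at p is the Riemannian
   metric at p. *)
Definition perpendicular (R : realType) (G1 G2 : set (hplane R)) : Prop :=
  exists p v1 v2,
    [/\ unit_tangent p v1, unit_tangent p v2, lor v1 v2 = 0,
        G1 = geodesic_from p v1 & G2 = geodesic_from p v2].

(* The geodesic segment [p, q]; it is [set p] when p = q. *)
Definition segment (R : realType) (p q : hplane R) : set (hplane R) :=
  [set z | exists s t : R,
     [/\ 0 <= s, 0 <= t & hlift z = s *: hlift p + t *: hlift q]].

Definition segment_of_length (R : realType) (S : set (hplane R)) (l : R) : Prop :=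
  exists p q, S = segment p q /\ hdist p q = l.

Definition disc (R : realType) (D : set (hplane R)) : Prop :=
  exists (c : hplane R) (r : R), 0 < r /\ D = [set p | hdist c p <= r].

Definition bdry (R : realType) (K : set (hplane R)) : set (hplane R) :=
  closure K `\` interior K.

Definition body (R : realType) (K : set (hplane R)) : Prop :=
  [/\ compact K, interior K !=set0 & K = closure (interior K)].

Definition meets_in_arc (R : realType) (G S : set (hplane R)) : Prop :=
  exists p q, p <> q /\ G `&` S = segment p q.

Definition convex_body (R : realType) (K : set (hplane R)) : Prop :=
  body K /\
  forall G, geodesic G ->
    (forall x y z, (G `&` bdry K) x -> (G `&` bdry K) y -> (G `&` bdry K) z ->
       [\/ x = y, y = z | x = z])
    \/ meets_in_arc G (bdry K).

Definition supporting (R : realType) (K G : set (hplane R)) : Prop :=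
  geodesic G /\
  ((exists x, G `&` bdry K = [set x]) \/ meets_in_arc G (bdry K)).

(* A simple closed curve with a regular C^1 parametrization of period 1. *)
Definition C1_closed_curve (R : realType) (S : set (hplane R)) : Prop :=
  exists x y : R -> R,
    [/\ (forall t, derivable x t 1 /\ derivable y t 1),
        continuous (derive1 x) /\ continuous (derive1 y),
        (forall t, (derive1 x t, derive1 y t) <> (0, 0)),
        (forall t, x (t + 1) = x t /\ y (t + 1) = y t) /\
        (forall s t, 0 <= s < 1 -> 0 <= t < 1 ->
           (x s, y s) = (x t, y t) -> s = t)
      & S = range (fun t => (x t, y t))].

(* N is the geodesic through x perpendicular to G. *)
Definition normal_at (R : realType) (G : set (hplane R)) (x : hplane R)
    (N : set (hplane R)) : Prop :=
  perpendicular N G /\ N x.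

Definition projection (R : realType) (G K : set (hplane R)) : set (hplane R) :=
  [set x | G x /\ exists N, normal_at G x N /\ K `&` N !=set0].

(* w is the width of K at the boundary point x: G1 is the supporting geodesic
   at x, N is n_K(x), G2 is the other supporting geodesic orthogonal to N, and
   y is phi(x). *)
Definition width_at (R : realType) (K : set (hplane R)) (x : hplane R) (w : R) :
    Prop :=
  exists G1 N G2 y,
    [/\ supporting K G1 /\ G1 x,
        normal_at G1 x N,
        [/\ supporting K G2, G2 <> G1 & perpendicular G2 N],
        N y /\ G2 y
      & hdist x y = w].

Definition constant_width (R : realType) (K : set (hplane R)) (w : R) : Prop :=
  forall x, bdry K x -> width_at K x w.

(* Main.v *)
Require Import Defs.
From mathcomp Require Import all_boot all_order all_algebra.
From mathcomp Require Import all_classical all_reals all_analysis.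
From mathcomp Require Import ring lra.
Import Order.TTheory GRing.Theory Num.Theory.
Import numFieldNormedType.Exports.

(** In Minkowski space a geodesic is the zero set of a unit spacelike vector,
    and [cosh_dist p q = - lor p q] is the hyperbolic cosine of a distance, so
    that the geometry is linear algebra in orthonormal frames.

    Let [q] be a point of the body [K] farthest from a point [c] of [K].  Since
    the boundary is smooth, its tangent at [q] is the supporting geodesic and is
    perpendicular to the geodesic from [c] to [q], which is therefore the normal
    at [q] ([farthest_normal]).  The definition of the width at [q] thus provides
    a second supporting geodesic perpendicular to this normal, at distance [w]
    from [q] ([width_at_farthest]).  This is used twice.

    - When [c] and [q] realize the diameter of [K], it shows that the diameter is
      [w] ([width_diameter]).
    - When [c] is the origin [O], the two supporting geodesics bound the
      projection of [K] on the normal, which passes through [O]: so the common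
      length of the projections is [w] ([projection_length]).

    Now let [q] be any boundary point and project [K] on the geodesic from [O]
    to [q].  The result is a segment of length [w] whose endpoints are feet of
    points of [K].  Projecting shortens distances, strictly unless the points are
    on the geodesic ([cosh_dist_feet]), and the diameter is [w]: so the endpoints
    themselves are in [K].  As [q] is a boundary point and [O] an interior one,
    [q] is one of these endpoints, so that [K] is on one side of the geodesic
    perpendicular to [Oq] at [q] ([central_normal]).  All normals then pass
    through [O], the distance to [O] has derivative 0 along the boundary curve
    ([bdry_equidistant]), and [K] is a disc centered at [O]
    ([equidistant_disc]).

    Convexity only speaks of the boundary points on a geodesic.  What is used of
    it is that a segment from an interior point to a point of [K] has its
    relative interior in the interior of [K] ([interior_convex]), and that [K]
    lies on one side of each supporting geodesic ([supporting_one_sided]). *)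

Set Implicit Arguments.
Unset Strict Implicit.
Unset Printing Implicit Defensive.
Local Open Scope classical_set_scope.
Local Open Scope ring_scope.

(** * Minkowski algebra *)

Section Minkowski.
Variable R : realType.
Implicit Types (u v n e : R * R * R) (p q x y z a b : hplane R) (s t : R).

Lemma lorC u v : lor u v = lor v u.
Proof. by rewrite /lor; ring. Qed.

Lemma scale_triple s (r1 r2 r3 : R) :
  s *: (r1, r2, r3) = (s * r1, s * r2, s * r3).
Proof. by []. Qed.

Lemma lorDl u v n : lor (u + v) n = lor u n + lor v n.
Proof.
case: u v n => [[u1 u2] u3] [[v1 v2] v3] [[n1 n2] n3].
by rewrite /lor /=; ring.
Qed.

Lemma lorZl s u v : lor (s *: u) v = s * lor u v.
Proof. by case: u => [[u1 u2] u3]; rewrite scale_triple /lor /=; ring. Qed.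

Lemma lorDr u v n : lor n (u + v) = lor n u + lor n v.
Proof. by rewrite !(lorC n) lorDl. Qed.

Lemma lorZr s u v : lor u (s *: v) = s * lor u v.
Proof. by rewrite !(lorC u) lorZl. Qed.

Definition lorE := (lorDl, lorDr, lorZl, lorZr).

Lemma lor0l u : lor 0 u = 0.
Proof. by rewrite /lor /=; ring. Qed.

(** The hyperbolic cosine of [hdist], polynomial in the lifted points. *)
Definition cosh_dist p q : R := - lor (hlift p) (hlift q).

Lemma hlift_gt0 p : 0 < (hlift p).2.
Proof. by have [] // := (hyperboloidP (hlift p)).2 (ex_intro _ p erefl). Qed.

Lemma lor_hlift p : lor (hlift p) (hlift p) = -1.
Proof. by have [] // := (hyperboloidP (hlift p)).2 (ex_intro _ p erefl). Qed.

Lemma hlift_inj : injective (@hlift R).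
Proof. by move=> [x y] [x' y'] [-> ->]. Qed.

Lemma hlift_fst u : lor u u = -1 -> 0 < u.2 -> hlift u.1 = u.
Proof.
move=> uu u0; have [p ->] := (hyperboloidP u).1 (conj uu u0).
by case: p.
Qed.

Lemma cosh_distpp p : cosh_dist p p = 1.
Proof. by rewrite /cosh_dist lor_hlift opprK. Qed.

(** Lagrange's identity turns the reversed Cauchy-Schwarz inequality into a sum
    of squares. *)
Lemma cosh_dist_ge1_eq p q : 1 <= cosh_dist p q /\ (cosh_dist p q = 1 -> p = q).
Proof.
have := lor_hlift p; have := lor_hlift q.
have := hlift_gt0 p; have := hlift_gt0 q.
have -> : cosh_dist p q =
    - (p.1 * q.1 + p.2 * q.2 - (hlift p).2 * (hlift q).2) by [].
rewrite /lor; case: p q => [a b] [a' b'] /=.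
move: (Num.sqrt _) (Num.sqrt _) => c d d0 c0 hq hp.
have id : (c * d) ^+ 2 = (1 + (a * a' + b * b')) ^+ 2
    + ((a - a') ^+ 2 + (b - b') ^+ 2 + (a * b' - b * a') ^+ 2).
  have -> : (c * d) ^+ 2 = (c * c) * (d * d) by ring.
  have -> : c * c = 1 + a * a + b * b by lra.
  have -> : d * d = 1 + a' * a' + b' * b' by lra.
  ring.
have cd0 : 0 < c * d by exact: mulr_gt0.
have h3 := sqr_ge0 (a - a'); have h2 := sqr_ge0 (b - b').
have h1 := sqr_ge0 (a * b' - b * a').
split; first by nra.
move=> h.
have h4 : (a - a') ^+ 2 + (b - b') ^+ 2 + (a * b' - b * a') ^+ 2 = 0.
  have e : c * d = 1 + (a * a' + b * b') by lra.
  by move: id; rewrite e; lra.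
have /eqP : (a - a') ^+ 2 = 0 by lra.
rewrite sqrf_eq0 subr_eq0 => /eqP ->.
have /eqP : (b - b') ^+ 2 = 0 by lra.
by rewrite sqrf_eq0 subr_eq0 => /eqP ->.
Qed.

Lemma cosh_dist_ge1 p q : 1 <= cosh_dist p q.
Proof. by have [] := cosh_dist_ge1_eq p q. Qed.

Lemma cosh_dist_eq1 p q : cosh_dist p q = 1 -> p = q.
Proof. by have [] := cosh_dist_ge1_eq p q. Qed.

Lemma cosh_dist_gt1 p q : p <> q -> 1 < cosh_dist p q.
Proof.
by move=> pq; rewrite lt_neqAle cosh_dist_ge1 eq_sym andbT; apply/eqP => /cosh_dist_eq1.
Qed.

Lemma lor_hlift_lt0 p q : lor (hlift p) (hlift q) < 0.
Proof. by have := cosh_dist_ge1 p q; rewrite /cosh_dist; lra. Qed.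

(** On the lower sheet, the product with a point of the upper one is positive. *)
Lemma future_hlift u p :
  lor u u = -1 -> lor u (hlift p) < 0 -> hlift u.1 = u.
Proof.
move=> uu up; apply: hlift_fst => //; rewrite ltNge; apply/negP => u0.
have pp := lor_hlift p; have p0 := hlift_gt0 p.
have u'0 : 0 < - u.2.
  rewrite lt_def oppr_ge0 u0 andbT oppr_eq0; apply/eqP => e.
  move: uu; rewrite /lor e mul0r subr0 => h.
  by have := sqr_ge0 u.1.1; have := sqr_ge0 u.1.2; rewrite !expr2; lra.
have h : hlift (- u.1.1, - u.1.2) = (- u.1.1, - u.1.2, - u.2).
  apply: (@hlift_fst (- u.1.1, - u.1.2, - u.2)) => //.
  by rewrite /lor /= !mulrNN.
have := lor_hlift_lt0 (- u.1.1, - u.1.2) p; rewrite h.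
by move: up; rewrite /lor /=; lra.
Qed.

(** ** Orthonormal frames *)

Definition frame p v n : Prop :=
  [/\ unit_tangent p v, unit_tangent p n & lor v n = 0].

Definition lcross u v : R * R * R :=
  (u.1.2 * v.2 - u.2 * v.1.2, u.2 * v.1.1 - u.1.1 * v.2,
   u.1.2 * v.1.1 - u.1.1 * v.1.2).

Lemma frame_lcross p v : unit_tangent p v -> frame p v (lcross (hlift p) v).
Proof.
move=> [pv vv]; split=> //; last first.
  by rewrite /lor /lcross /=; ring.
split; first by rewrite /lor /lcross /=; ring.
have -> : lor (lcross (hlift p) v) (lcross (hlift p) v)
   = lor (hlift p) v ^+ 2 - lor (hlift p) (hlift p) * lor v v.
  by rewrite /lor /lcross /=; ring.
by rewrite pv vv lor_hlift; ring.
Qed.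

Lemma expand_lcross p v u : unit_tangent p v ->
  u = - lor u (hlift p) *: hlift p + lor u v *: v
      + lor u (lcross (hlift p) v) *: lcross (hlift p) v.
Proof.
move=> [pv vv]; have pp := lor_hlift p; move: (hlift p) pv pp => P pv pp.
have id : (lor P v ^+ 2 - lor P P * lor v v) *: u =
    (lor u v * lor P v - lor u P * lor v v) *: P
    + (lor u P * lor P v - lor u v * lor P P) *: v + lor u (lcross P v) *: lcross P v.
  case: u P v {pv vv pp} => [[u1 u2] u3] [[P1 P2] P3] [[v1 v2] v3].
  by rewrite !scale_triple; congr (_, _, _); rewrite /lor /lcross /=; ring.
by move: id; rewrite pv vv pp !(expr0n, mulr0, mulr1, mulrN, sub0r, opprK, scale1r).
Qed.

(** The third vector of a frame is [lcross] up to sign, and the expansion is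
    even in it. *)
Lemma frame_expand p v n u : frame p v n ->
  u = - lor u (hlift p) *: hlift p + lor u v *: v + lor u n *: n.
Proof.
move=> [pv [pn nn] vn]; rewrite {1}(expand_lcross u pv); congr (_ + _).
set m := lcross _ _.
have en : n = lor n m *: m.
  rewrite {1}(expand_lcross n pv) -/m (lorC n (hlift p)) pn (lorC n v) vn.
  by rewrite oppr0 !scale0r !add0r.
have [_ [_ mm] _] := frame_lcross pv; rewrite -/m in mm.
have nm1 : lor n m * lor n m = 1.
  by move: nn; rewrite {1 2}en !lorE mm mulr1 mulrC.
by rewrite {1 2}en !lorE scalerA mulrAC nm1 mul1r.
Qed.

Lemma frame_lor p v n u u' : frame p v n ->
  lor u u' = - lor u (hlift p) * lor u' (hlift p) + lor u v * lor u' v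
             + lor u n * lor u' n.
Proof.
move=> F; rewrite {1}(frame_expand u F) !lorE.
by rewrite !(lorC u').
Qed.

Lemma frameC p v n : frame p v n -> frame p n v.
Proof. by move=> [pv pn vn]; split; rewrite // lorC. Qed.

Lemma unit_tangentN p v : unit_tangent p v -> unit_tangent p (- v).
Proof.
by rewrite -scaleN1r => -[pv vv]; split; rewrite !lorE ?pv ?vv; ring.
Qed.

Lemma frameN p v n : frame p v n -> frame p (- v) n.
Proof.
move=> [pv pn vn]; split=> //; first exact: unit_tangentN.
by rewrite -scaleN1r lorE vn mulr0.
Qed.

Lemma lorNl u v : lor (- u) v = - lor u v.
Proof. by rewrite -scaleN1r lorE mulN1r. Qed.

Lemma lorNr u v : lor u (- v) = - lor u v.
Proof. by rewrite -scaleN1r lorE mulN1r. Qed.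

(** ** Geodesics as zero sets *)

Definition hline n : set (hplane R) := [set q | lor n (hlift q) = 0].

Lemma hlineN n : hline (- n) = hline n.
Proof.
by apply/seteqP; split=> x; rewrite /hline /= lorNl => h; lra.
Qed.

Lemma geodesic_from_hline p v n : frame p v n -> geodesic_from p v = hline n.
Proof.
move=> F; have [[pv vv] [pn nn] vn] := F.
apply/seteqP; split=> q; rewrite /geodesic_from /hline /=.
  by move=> [s [t ->]]; rewrite !lorE lorC pn (lorC n) vn; ring.
move=> h; exists (- lor (hlift q) (hlift p)), (lor (hlift q) v).
by rewrite {1}(frame_expand (hlift q) F) (lorC (hlift q) n) h scale0r addr0.
Qed.

Lemma geodesic_hline p v n : frame p v n -> geodesic (hline n).
Proof.
by move=> F; exists p, v; rewrite (geodesic_from_hline F); case: F.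
Qed.

Lemma frame_at n p : lor n n = 1 -> hline n p -> exists v, frame p v n.
Proof.
move=> nn np; exists (lcross (hlift p) n); apply/frameC/frame_lcross.
by split; rewrite // lorC.
Qed.

Lemma frame_mem p v n : frame p v n -> hline n p.
Proof. by move=> [_ [pn _] _]; rewrite /hline /= lorC. Qed.

(** ** Points along a geodesic *)

(** [s] is the hyperbolic sine of the arc length from [p]. *)
Definition hexp p v s : hplane R := (Num.sqrt (1 + s ^+ 2) *: hlift p + s *: v).1.

Lemma sqrt1D_gt0 s : 0 < Num.sqrt (1 + s ^+ 2).
Proof. by rewrite sqrtr_gt0; have := sqr_ge0 s; lra. Qed.

Lemma sqr_sqrt1D s : Num.sqrt (1 + s ^+ 2) ^+ 2 = 1 + s ^+ 2.
Proof. by rewrite sqr_sqrtr //; have := sqr_ge0 s; lra. Qed.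

Lemma hlift_hexp p v s : unit_tangent p v ->
  hlift (hexp p v s) = Num.sqrt (1 + s ^+ 2) *: hlift p + s *: v.
Proof.
move=> [pv vv]; apply: (@future_hlift _ p).
  rewrite !lorE lor_hlift (lorC v) pv vv.
  by have := sqr_sqrt1D s; rewrite !expr2; lra.
rewrite !lorE lor_hlift (lorC v) pv mulr0 addr0 mulrN1 oppr_lt0.
exact: sqrt1D_gt0.
Qed.

Lemma hexp0 p v : unit_tangent p v -> hexp p v 0 = p.
Proof.
move=> pv; apply: hlift_inj; rewrite (hlift_hexp _ pv).
by rewrite expr0n /= addr0 sqrtr1 scale1r scale0r addr0.
Qed.

Lemma hexpN p v s : hexp p (- v) s = hexp p v (- s).
Proof. by rewrite /hexp sqrrN scalerN scaleNr. Qed.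

Lemma lor_hexp_v p v s : unit_tangent p v -> lor (hlift (hexp p v s)) v = s.
Proof. by move=> pv; rewrite (hlift_hexp _ pv) !lorE pv.1 pv.2; ring. Qed.

Lemma hexp_inj p v : unit_tangent p v -> injective (hexp p v).
Proof. by move=> pv s t e; rewrite -(lor_hexp_v s pv) e lor_hexp_v. Qed.

Lemma cosh_dist_hexp p v s : unit_tangent p v ->
  cosh_dist p (hexp p v s) = Num.sqrt (1 + s ^+ 2).
Proof.
by move=> pv; rewrite /cosh_dist (hlift_hexp _ pv) !lorE lor_hlift pv.1; ring.
Qed.

Lemma hline_hexp p v n q : frame p v n -> hline n q ->
  q = hexp p v (lor (hlift q) v).
Proof.
move=> F nq; have [pv _ _] := F; apply: hlift_inj; rewrite (hlift_hexp _ pv).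
have nq' : lor (hlift q) n = 0 by rewrite lorC.
rewrite {1}(frame_expand (hlift q) F) nq' scale0r addr0; congr (_ *: _ + _).
have := frame_lor (hlift q) (hlift q) F; rewrite lor_hlift nq' => h.
have -> : 1 + lor (hlift q) v ^+ 2 = (- lor (hlift q) (hlift p)) ^+ 2.
  by rewrite !expr2; lra.
rewrite sqrtr_sqr ger0_norm // oppr_ge0; exact/ltW/lor_hlift_lt0.
Qed.

Lemma hexp_hline p v n s : frame p v n -> hline n (hexp p v s).
Proof.
move=> F; rewrite -(geodesic_from_hline F) /geodesic_from /=.
by exists (Num.sqrt (1 + s ^+ 2)), s; apply: hlift_hexp; case: F.
Qed.

(** The direction from [p] to [q] is the component of [q] orthogonal to [p]. *)
Lemma direction p q : p <> q ->
  exists v s, [/\ unit_tangent p v, 0 < s & q = hexp p v s].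
Proof.
move=> /cosh_dist_gt1; set c := cosh_dist p q => c1.
pose s := Num.sqrt (c ^+ 2 - 1).
have s2 : s ^+ 2 = c ^+ 2 - 1 by rewrite sqr_sqrtr //; nra.
have s0 : 0 < s by rewrite sqrtr_gt0; nra.
have s0' : s != 0 by rewrite gt_eqF.
pose v := s^-1 *: (hlift q - c *: hlift p).
have lpq : lor (hlift p) (hlift q) = - c by rewrite /c /cosh_dist opprK.
have pv : unit_tangent p v.
  split; rewrite /v -scaleNr !lorE ?(lorC (hlift q) (hlift p)) !lor_hlift lpq.
    by ring.
  rewrite [LHS](_ : _ = s^-1 ^+ 2 * (c ^+ 2 - 1)); last by ring.
  by rewrite -s2 exprVn mulVf // expf_neq0.
exists v, s; split=> //; apply: hlift_inj; rewrite (hlift_hexp _ pv).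
have -> : 1 + s ^+ 2 = c ^+ 2 by rewrite s2; ring.
rewrite sqrtr_sqr ger0_norm; last by lra.
by rewrite scalerA divff // scale1r addrC subrK.
Qed.

Lemma geodesic_through p q : p <> q ->
  exists v n s, [/\ frame p v n, 0 < s & q = hexp p v s].
Proof.
move=> /direction[v [s [pv s0 ->]]]; exists v, (lcross (hlift p) v), s.
by split=> //; exact: frame_lcross.
Qed.

(** A normal of the line is orthogonal to the frame vectors [p] and [v], hence a
    multiple of [n]. *)
Lemma hline_eq p v n n' : frame p v n -> lor n' n' = 1 ->
  hline n = hline n' -> n' = n \/ n' = - n.
Proof.
move=> F nn' e; have [pv [pn nn] vn] := F.
have pn' : lor n' (hlift p) = 0.
  by have : hline n' p by rewrite -e; exact: frame_mem F.
have vn' : lor n' v = 0.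
  have : hline n' (hexp p v 1) by rewrite -e; exact: hexp_hline F.
  by rewrite /hline /= (hlift_hexp _ pv) !lorE pn' mulr0 add0r mul1r.
have en := frame_expand n' F.
rewrite pn' vn' oppr0 !scale0r !add0r in en.
have : lor n' n ^+ 2 = 1 by move: nn'; rewrite {1 2}en !lorE nn; lra.
move/eqP; rewrite sqrf_eq1 => /orP[] /eqP h; rewrite en h.
  by left; rewrite scale1r.
by right; rewrite scaleN1r.
Qed.

Lemma perpendicularP N G : perpendicular N G ->
  exists p v1 v2, [/\ frame p v1 v2, N = hline v2 & G = hline v1].
Proof.
move=> [p [v1 [v2 [pv1 pv2 v12 -> ->]]]]; exists p, v1, v2; split=> //.
  exact: geodesic_from_hline.
by apply: geodesic_from_hline; apply: frameC.
Qed.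

Lemma perpendicular_hline p v1 v2 : frame p v1 v2 ->
  perpendicular (hline v2) (hline v1).
Proof.
move=> F; have [pv1 pv2 v12] := F; exists p, v1, v2; split=> //.
  by rewrite (geodesic_from_hline F).
by rewrite (geodesic_from_hline (frameC F)).
Qed.

(** ** Segments *)

Lemma segmentC a b : segment a b = segment b a.
Proof.
by apply/seteqP; split=> z /= [s [t [s0 t0 e]]]; exists t, s; rewrite addrC.
Qed.

Lemma segment_l a b : segment a b a.
Proof. by exists 1, 0; rewrite scale1r scale0r addr0. Qed.

Lemma segment_r a b : segment a b b.
Proof. by rewrite segmentC; exact: segment_l. Qed.

(** The coordinates of a point of a segment are at most 1, hence so is the
    determinant that relates two pairs of points, and the Gram determinant
    [cosh_dist ^ 2 - 1] is multiplied by the square of the latter. *)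
Lemma segment_cosh_dist_le a b x y : segment a b x -> segment a b y ->
  cosh_dist x y <= cosh_dist a b.
Proof.
move=> [s [t [s0 t0 ex]]] [s' [t' [s'0 t'0 ey]]].
have c1 := cosh_dist_ge1 a b; set c := cosh_dist a b in c1 *.
have xy1 := cosh_dist_ge1 x y.
have lab : lor (hlift a) (hlift b) = - c by rewrite /c /cosh_dist opprK.
have lba : lor (hlift b) (hlift a) = - c by rewrite lorC.
have := lor_hlift x; rewrite {1 2}ex !lorE lab lba !lor_hlift => hx.
have := lor_hlift y; rewrite {1 2}ey !lorE lab lba !lor_hlift => hy.
have exy : cosh_dist x y = s * s' + t * t' + (s * t' + t * s') * c.
  by rewrite /cosh_dist ex ey !lorE lab lba !lor_hlift; ring.
have st : s ^+ 2 + t ^+ 2 + 2 * s * t * c = 1 by rewrite !expr2; lra.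
have st' : s' ^+ 2 + t' ^+ 2 + 2 * s' * t' * c = 1 by rewrite !expr2; lra.
have id : cosh_dist x y ^+ 2 - 1 = (s * t' - t * s') ^+ 2 * (c ^+ 2 - 1).
  transitivity (cosh_dist x y ^+ 2
      - (s ^+ 2 + t ^+ 2 + 2 * s * t * c) * (s' ^+ 2 + t' ^+ 2 + 2 * s' * t' * c)).
    by rewrite st st' mulr1.
  by rewrite exy; ring.
have pc : 0 <= s * t * c by rewrite !mulr_ge0 //; lra.
have pc' : 0 <= s' * t' * c by rewrite !mulr_ge0 //; lra.
have s1 : s <= 1 by nra.
have t1 : t <= 1 by nra.
have s'1 : s' <= 1 by nra.
have t'1 : t' <= 1 by nra.
have h1 : s * t' <= 1 by rewrite -[1]mulr1 ler_pM.
have h2 : t * s' <= 1 by rewrite -[1]mulr1 ler_pM.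
have h3 : 0 <= s * t' by rewrite mulr_ge0.
have h4 : 0 <= t * s' by rewrite mulr_ge0.
have d1 : (s * t' - t * s') ^+ 2 <= 1 by nra.
have : cosh_dist x y ^+ 2 <= c ^+ 2.
  have : (s * t' - t * s') ^+ 2 * (c ^+ 2 - 1) <= c ^+ 2 - 1.
    by rewrite ler_piMl // subr_ge0 expr_ge1 //; lra.
  by rewrite -id; lra.
by rewrite ler_pXn2r // nnegrE; lra.
Qed.

(** ** The distance *)

Lemma arcosh_lt s t : 1 <= s -> s < t -> arcosh s < arcosh t.
Proof.
move=> s1 st; rewrite /arcosh ltr_ln ?posrE.
- apply: ltr_leD => //; apply: ler_wsqrtr; rewrite lerD2r ler_pXn2r ?nnegrE //.
  + exact: ltW.
  + exact: le_trans s1.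
  + by apply: le_trans (ltW st); exact: le_trans s1.
- by apply: ltr_wpDr; [exact: sqrtr_ge0 | exact: lt_le_trans s1].
- apply: ltr_wpDr; first exact: sqrtr_ge0.
  by apply: lt_trans st; exact: lt_le_trans s1.
Qed.

Lemma arcosh_le s t : 1 <= s -> 1 <= t -> (arcosh s <= arcosh t) = (s <= t).
Proof.
move=> s1 t1; case: (ltgtP s t) => [st|ts|->]; last exact: lexx.
  exact/ltW/arcosh_lt.
by apply/negbTE; rewrite -ltNge; exact: arcosh_lt.
Qed.

Lemma arcosh_inj s t : 1 <= s -> 1 <= t -> arcosh s = arcosh t -> s = t.
Proof.
by move=> s1 t1 e; apply/eqP; rewrite eq_le -(arcosh_le s1 t1) -(arcosh_le t1 s1) e lexx.
Qed.

Lemma arcosh_gt0 t : 1 < t -> 0 < arcosh t.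
Proof.
move=> t1; rewrite /arcosh ln_gt0 //; apply: ltr_wpDr => //; exact: sqrtr_ge0.
Qed.

End Minkowski.

(** * Continuity in the chart *)

Section Continuity.
Variable R : realType.
Implicit Types (u v : R * R * R) (p z : hplane R).

Lemma cvg_hlift2 (T : Type) (F : set_system T) {FF : Filter F}
    (f : T -> hplane R) z :
  f @ F --> z -> (hlift (f t)).2 @[t --> F] --> (hlift z).2.
Proof.
move=> fz.
have f1 : (f t).1 @[t --> F] --> z.1 by apply: cvg_comp fz _; exact: cvg_fst.
have f2 : (f t).2 @[t --> F] --> z.2 by apply: cvg_comp fz _; exact: cvg_snd.
rewrite /hlift /=; apply: continuous_cvg; first exact: sqrt_continuous.
apply: cvgD; last exact: (cvgM f2 f2).
by apply: cvgD; [exact: cvg_cst | exact: (cvgM f1 f1)].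
Qed.

Lemma continuous_lor u : continuous (fun z => lor u (hlift z)).
Proof.
move=> z; rewrite /lor; apply: cvgB; first apply: cvgD.
- by apply: cvgM; [exact: cvg_cst | exact: cvg_fst].
- by apply: cvgM; [exact: cvg_cst | exact: cvg_snd].
- by apply: cvgM; [exact: cvg_cst | apply: cvg_hlift2; exact: cvg_id].
Qed.

Lemma continuous_cosh_dist :
  continuous (fun z : hplane R * hplane R => cosh_dist z.1 z.2).
Proof.
move=> z.
have f1 : t.1 @[t --> z] --> z.1 by exact: cvg_fst.
have f2 : t.2 @[t --> z] --> z.2 by exact: cvg_snd.
have f11 : t.1.1 @[t --> z] --> z.1.1 by apply: cvg_comp f1 _; exact: cvg_fst.
have f12 : t.1.2 @[t --> z] --> z.1.2 by apply: cvg_comp f1 _; exact: cvg_snd.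
have f21 : t.2.1 @[t --> z] --> z.2.1 by apply: cvg_comp f2 _; exact: cvg_fst.
have f22 : t.2.2 @[t --> z] --> z.2.2 by apply: cvg_comp f2 _; exact: cvg_snd.
apply: cvgN; apply: cvgB; last exact: (cvgM (cvg_hlift2 f1) (cvg_hlift2 f2)).
by apply: cvgD; [exact: (cvgM f11 f21) | exact: (cvgM f12 f22)].
Qed.

Lemma continuous_hexp p v : continuous (hexp p v).
Proof.
move=> s.
have c : Num.sqrt (1 + t ^+ 2) @[t --> s] --> Num.sqrt (1 + s ^+ 2).
  apply: continuous_cvg; first exact: sqrt_continuous.
  apply: cvgD; first exact: cvg_cst.
  by apply: (cvgM cvg_id cvg_id).
have lin (a b : R) : Num.sqrt (1 + t ^+ 2) * a + t * b @[t --> s]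
    --> Num.sqrt (1 + s ^+ 2) * a + s * b.
  by apply: cvgD; apply: cvgM => //; exact: cvg_cst.
exact: (cvg_pair (lin p.1 v.1.1) (lin p.2 v.1.2)).
Qed.

End Continuity.

(** * Convex bodies *)

Section ConvexBody.
Variables (R : realType) (K : set (hplane R)).
Hypothesis K_convex : convex_body K.
Implicit Types (n v : R * R * R) (p q z c : hplane R) (r s t : R).

Lemma closed_body : closed K.
Proof. by have [[_ _ ->] _] := K_convex; exact: closed_closure. Qed.

Lemma bdryP z : bdry K z <-> K z /\ ~ interior K z.
Proof.
have e : closure K = K by apply/esym/closure_id/closed_body.
by rewrite /bdry e.
Qed.

Lemma interior_not_bdry z : interior K z -> ~ bdry K z.
Proof. by move=> Kz /bdryP[]. Qed.

Lemma interior_mem z : interior K z -> K z.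
Proof. exact: interior_subset. Qed.

(** The preimages of [K] and of its interior coincide on a segment without
    boundary points, so that they are both open and closed in it. *)
Lemma crossing (f : R -> hplane R) s t : continuous f -> s <= t ->
  interior K (f s) -> ~ interior K (f t) ->
  exists r, [/\ s < r, r <= t & bdry K (f r)].
Proof.
move=> cf st Ks Kt; apply: contrapT => no.
have eqB : `[s, t] `&` f @^-1` interior K = `[s, t] `&` f @^-1` K.
  apply/seteqP; split=> r [rst Kr].
    by split; [exact: rst | exact: interior_mem].
  split; first exact: rst.
  apply: contrapT => iKr; apply: no; exists r.
  move: rst; rewrite /= in_itv /= => /andP[sr rt].
  split; [|exact: rt|by apply/bdryP; split].
  by rewrite lt_neqAle sr andbT; apply/eqP => e; apply: iKr; rewrite /= -e.
suff e : `[s, t] `&` f @^-1` interior K = [set` `[s, t]].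
  suff [] : (`[s, t] `&` f @^-1` interior K) t by [].
  by rewrite e /= in_itv /= st lexx.
apply: segment_connected.
- by exists s; split; [rewrite /= in_itv /= lexx | exact: Ks].
- exists (f @^-1` interior K); last by [].
  by apply: open_comp; [move=> x _; exact: cf | exact: open_interior].
- exists (f @^-1` K); last exact: eqB.
  by apply: preimage_closed; [move=> x _; exact: cf | exact: closed_body].
Qed.

Lemma cosh_dist_max c p : K p ->
  exists q, K q /\ forall z, K z -> cosh_dist c z <= cosh_dist c q.
Proof.
move=> Kp; have [[Kc _ _] _] := K_convex.
have cont : {within K, continuous (cosh_dist c)}.
  by apply: continuous_subspaceT => z; apply: cvgN; exact: continuous_lor.
have [q] := compact_EVT_max (ex_intro _ p Kp) Kc cont.
rewrite inE => Kq qmax; exists q; split=> // z Kz; apply: qmax; exact: mem_set.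
Qed.

Lemma diameter p : K p -> exists q1 q2, [/\ K q1, K q2 &
  forall z1 z2, K z1 -> K z2 -> cosh_dist z1 z2 <= cosh_dist q1 q2].
Proof.
move=> Kp; have [[Kc _ _] _] := K_convex.
have cont : {within K `*` K,
    continuous (fun z : hplane R * hplane R => cosh_dist z.1 z.2)}.
  exact: continuous_subspaceT (@continuous_cosh_dist R).
have [[q1 q2]] := compact_EVT_max (ex_intro _ (p, p) (conj Kp Kp))
  (compact_setX Kc Kc) cont.
rewrite inE => -[/= Kq1 Kq2] qmax; exists q1, q2; split=> // z1 z2 Kz1 Kz2.
by apply: (qmax (z1, z2)); exact: mem_set.
Qed.

Lemma ray_exit p v s : unit_tangent p v -> interior K (hexp p v s) ->
  exists r, s < r /\ bdry K (hexp p v r).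
Proof.
move=> pv Ks; have [q [_ qmax]] := cosh_dist_max p (interior_mem Ks).
pose t := Num.max s (cosh_dist p q).
have st : s <= t by rewrite le_max lexx.
have qt : cosh_dist p q <= t by rewrite le_max lexx orbT.
have [|r [sr _ br]] := crossing (@continuous_hexp R p v) st Ks; last by exists r.
move=> /interior_mem/qmax; rewrite (cosh_dist_hexp _ pv).
have := sqr_sqrt1D t; have := sqrt1D_gt0 t; have := cosh_dist_ge1 p q.
by move=> h1 h2 h3 h4; nra.
Qed.

Lemma segment_cone p q z1 z2 z s t : segment p q z1 -> segment p q z2 ->
  0 <= s -> 0 <= t -> hlift z = s *: hlift z1 + t *: hlift z2 -> segment p q z.
Proof.
move=> [a [b [a0 b0 e1]]] [a' [b' [a'0 b'0 e2]]] s0 t0 ez.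
exists (s * a + t * a'), (s * b + t * b'); rewrite !addr_ge0 ?mulr_ge0 //.
split=> //; rewrite ez e1 e2 !scalerDr !scalerA !scalerDl.
by rewrite addrACA.
Qed.

Lemma hexp_between p v r s : unit_tangent p v -> r < 0 -> 0 < s ->
  exists a b, [/\ 0 <= a, 0 <= b &
    hlift p = a *: hlift (hexp p v r) + b *: hlift (hexp p v s)].
Proof.
move=> pv r0 s0; rewrite !(hlift_hexp _ pv).
move: (sqrt1D_gt0 r) (sqrt1D_gt0 s); set c := Num.sqrt _; set d := Num.sqrt _.
move=> c0 d0; have m0 : 0 < s * c - r * d by nra.
have mN : s * c - r * d != 0 by rewrite gt_eqF.
exists (s / (s * c - r * d)), (- r / (s * c - r * d)).
rewrite !divr_ge0 ?oppr_ge0 ?(ltW m0) ?(ltW s0) ?(ltW r0) //; split=> //.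
rewrite !scalerDr !scalerA addrACA -!scalerDl.
have -> : s / (s * c - r * d) * r + - r / (s * c - r * d) * s = 0 by field.
have -> : s / (s * c - r * d) * c + - r / (s * c - r * d) * d = 1 by field.
by rewrite scale1r scale0r addr0.
Qed.

(** Such an arc would contain the boundary points at [r] and [s], hence also [p],
    which lies between them. *)
Lemma arc_avoids_interior p v n r s : frame p v n -> interior K p ->
  r < 0 -> 0 < s -> bdry K (hexp p v r) -> bdry K (hexp p v s) ->
  ~ meets_in_arc (hline n) (bdry K).
Proof.
move=> F Kp r0 s0 br bs [a [b [_ e]]]; have [pv _ _] := F.
have [x [y [x0 y0 ep]]] := hexp_between pv r0 s0.
apply: (interior_not_bdry Kp).
suff [] : (hline n `&` bdry K) p by [].
by rewrite e; apply: segment_cone x0 y0 ep; rewrite -e; split=> //;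
  exact: hexp_hline F.
Qed.

Lemma bdry_three p v r s t : unit_tangent p v -> interior K p ->
  r < 0 -> 0 < s -> s < t ->
  bdry K (hexp p v r) -> bdry K (hexp p v s) -> bdry K (hexp p v t) -> False.
Proof.
move=> pv Kp r0 s0 st br bs bt; have F := frame_lcross pv.
set n := lcross _ _ in F.
have [_ /(_ _ (geodesic_hline F))[h|]] := K_convex; last first.
  exact: arc_avoids_interior F Kp r0 s0 br bs.
have mem x : bdry K (hexp p v x) -> (hline n `&` bdry K) (hexp p v x).
  by split=> //; exact: hexp_hline F.
by have [] := h _ _ _ (mem _ br) (mem _ bs) (mem _ bt);
  move=> /(hexp_inj pv) e; lra.
Qed.

(** Otherwise the geodesic through [p] and [q] would have three boundary points
    contradicting [bdry_three]: one between [p] and [z], one at or beyond [q], and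
    one on the other side of [p]. *)
Lemma interior_convex p q z s t : interior K p -> K q -> 0 < s -> 0 <= t ->
  hlift z = s *: hlift p + t *: hlift q -> interior K z.
Proof.
move=> Kp Kq s0 t0 ez; apply: contrapT => Kz.
have := lor_hlift z; rewrite ez !lorE !lor_hlift (lorC (hlift q)).
have := cosh_dist_ge1 p q; rewrite /cosh_dist => h1 h2.
have st : 0 <= s * t by rewrite mulr_ge0 // ltW.
have t1 : t < 1.
  have : 0 <= s * t * (- lor (hlift p) (hlift q) - 1) by apply: mulr_ge0; lra.
  by nra.
case: (pselect (p = q)) => [epq|pq].
  apply: Kz; suff -> : z = p by [].
  move: h2; rewrite -epq lor_hlift => h2; apply: hlift_inj; rewrite ez -epq.
  rewrite -scalerDl; have -> : s + t = 1 by nra.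
  by rewrite scale1r.
have [v [sq [pv sq0 eq]]] := direction pq; have F := frame_lcross pv.
have lzv : lor (hlift z) v = t * sq.
  by rewrite ez eq !lorE pv.1 (lor_hexp_v _ pv); ring.
have zl : hline (lcross (hlift p) v) z.
  have qn := hexp_hline sq F; have pn := frame_mem F.
  rewrite -eq /hline /= in qn; rewrite /hline /= in pn.
  by rewrite /hline /= ez !lorE qn pn; ring.
have ezh := hline_hexp F zl; rewrite lzv in ezh.
have sz0 : 0 <= t * sq by rewrite mulr_ge0 // ltW.
have [||r1 [r10 r1z br1]] := crossing (@continuous_hexp R p v) sz0.
- by rewrite (hexp0 pv).
- by rewrite -ezh.
have [r3 [r3q br3]] : exists r, sq <= r /\ bdry K (hexp p v r).
  case: (pselect (interior K q)) => [iq|niq].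
    rewrite eq in iq; have [r [sr br]] := ray_exit pv iq.
    by exists r; split=> //; exact: ltW.
  by exists sq; rewrite -eq; split=> //; apply/bdryP.
have [] := @ray_exit p (- v) 0 (unit_tangentN pv).
  by rewrite (hexp0 (unit_tangentN pv)).
move=> r0 [r00 br0]; rewrite hexpN in br0.
apply: (@bdry_three p v (- r0) r1 r3) => //; first by lra.
have : t * sq < sq by nra.
by lra.
Qed.

Lemma cone_point p q s t : 0 < s -> 0 <= t ->
  exists z r, 0 < r /\ hlift z = (r * s) *: hlift p + (r * t) *: hlift q.
Proof.
move=> s0 t0; have := cosh_dist_ge1 p q; have := lor_hlift_lt0 q p.
rewrite /cosh_dist; set c := lor (hlift p) (hlift q) => c0 c1.
have st : 0 <= s * t by rewrite mulr_ge0 // ltW.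
pose m := s ^+ 2 + t ^+ 2 - 2 * (s * t) * c.
have m0 : 0 < m by rewrite /m; nra.
pose r := (Num.sqrt m)^-1.
have r0 : 0 < r by rewrite invr_gt0 sqrtr_gt0.
have rm : r ^+ 2 * m = 1 by rewrite exprVn sqr_sqrtr ?ltW // mulVf ?gt_eqF.
pose u := (r * s) *: hlift p + (r * t) *: hlift q.
exists u.1, r; split=> //; apply: (@future_hlift _ _ p).
  rewrite /u !lorE !lor_hlift (lorC (hlift q)) -/c.
  by move: rm; rewrite /m; lra.
rewrite /u !lorE lor_hlift; have := mulr_gt0 r0 s0.
have rt : 0 <= r * t by rewrite mulr_ge0 // ltW.
by move=> h; nra.
Qed.

Lemma supporting_avoids_interior n p : supporting K (hline n) -> lor n n = 1 ->
  interior K p -> lor n (hlift p) <> 0.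
Proof.
move=> [_ supp] nn Kp np; have [v F] := frame_at nn np; have [pv _ _] := F.
have Kp' w : unit_tangent p w -> interior K (hexp p w 0) by move=> /hexp0 ->.
have [s [s0 bs]] := ray_exit pv (Kp' _ pv).
have pNv := unit_tangentN pv.
have [r [r0 br]] := ray_exit pNv (Kp' _ pNv); rewrite hexpN in br.
have r0' : - r < 0 by lra.
case: supp => [[x e]|]; last exact: arc_avoids_interior F Kp r0' s0 br bs.
have mem y : bdry K (hexp p v y) -> hexp p v y = x.
  move=> b; suff : [set x] (hexp p v y) by [].
  by rewrite -e; split=> //; exact: hexp_hline F.
have := hexp_inj pv (etrans (mem _ bs) (esym (mem _ br))); lra.
Qed.

Lemma lor_le0_closure n : (forall z, interior K z -> lor n (hlift z) <= 0) ->
  forall z, K z -> lor n (hlift z) <= 0.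
Proof.
move=> h z Kz; have [[_ _ eK] _] := K_convex; rewrite eK in Kz.
have cl : closed [set x | lor n (hlift x) <= 0].
  apply: (@preimage_closed _ _ (fun x => lor n (hlift x)) _ _ (@closed_le R 0)).
  by move=> x _; exact: continuous_lor.
suff : [set x | lor n (hlift x) <= 0] z by [].
by rewrite ((closure_id _).1 cl); exact: (closure_subset h Kz).
Qed.

(** A sign change would produce an interior point on the geodesic. *)
Lemma supporting_one_sided n : supporting K (hline n) -> lor n n = 1 ->
  (forall z, K z -> lor n (hlift z) <= 0) \/
  (forall z, K z -> lor (- n) (hlift z) <= 0).
Proof.
move=> supp nn.
have no0 := supporting_avoids_interior supp nn.
case: (pselect (exists2 p, interior K p & 0 < lor n (hlift p))) => [[p Kp p0]|no].
  right; apply: lor_le0_closure => q Kq; rewrite lorNl oppr_le0 leNgt.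
  apply/negP => q0.
  have [||z [r [r0 ez]]] := @cone_point p q (- lor n (hlift q)) (lor n (hlift p)).
  - by lra.
  - exact: ltW.
  apply: (no0 z); last by rewrite ez !lorE; ring.
  by apply: interior_convex Kp (interior_mem Kq) _ _ ez;
    [apply: mulr_gt0 => //; lra | apply: mulr_ge0; exact: ltW].
left; apply: lor_le0_closure => q Kq; rewrite leNgt; apply/negP => q0.
by apply: no; exists q.
Qed.

Lemma supporting_touches G : supporting K G -> exists z, G z /\ bdry K z.
Proof.
move=> [_ [[z e]|[p [q [_ e]]]]].
  by exists z; have : (G `&` bdry K) z by rewrite e.
by exists p; have : (G `&` bdry K) p by rewrite e; exact: segment_l.
Qed.

Lemma farthest_bdry c q : K q -> c <> q ->
  (forall z, K z -> cosh_dist c z <= cosh_dist c q) -> bdry K q.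
Proof.
move=> Kq cq qmax; apply/bdryP; split=> // iq.
have [v [s [cv s0 eq]]] := direction cq; rewrite eq in iq.
have [r [sr /bdryP[/qmax + _]]] := ray_exit cv iq.
rewrite eq !(cosh_dist_hexp _ cv).
have := sqr_sqrt1D s; have := sqrt1D_gt0 s.
have := sqr_sqrt1D r; have := sqrt1D_gt0 r.
by clear eq cq => h1 h2 h3 h4 h5; nra.
Qed.

End ConvexBody.

(** * The boundary curve *)

Section Curve.
Variable R : realType.
Implicit Types (S : set (hplane R)) (u : R * R * R) (t : R).

Lemma is_derive_hlift2 (x y : R -> R) t dx dy :
  is_derive t 1 x dx -> is_derive t 1 y dy ->
  is_derive t 1 (fun t => (hlift (x t, y t)).2)
    ((x t * dx + y t * dy) / (hlift (x t, y t)).2).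
Proof.
move=> xt yt.
have c0 := hlift_gt0 (x t, y t).
pose f := (fun t => 1 + x t ^+ 2 + y t ^+ 2).
have f0 : 0 < f t by have := sqr_ge0 (x t); have := sqr_ge0 (y t); rewrite /f; lra.
have fd : is_derive t 1 f (2 * (x t * dx + y t * dy)).
  have h := is_deriveD (is_deriveD (is_derive_cst (1 : R) t (1 : R))
    (is_deriveM xt xt)) (is_deriveM yt yt).
  apply: (@is_derive_eq _ _ _ f _ _ _ _ h).
  by rewrite /GRing.scale /=; ring.
have h := is_derive1_comp (is_derive1_sqrt f0) fd.
apply: (@is_derive_eq _ _ _ (Num.sqrt \o f) _ _ _ _ h).
rewrite /hlift /= -/(f t) in c0 *.
by field; rewrite gt_eqF.
Qed.

(** A chart-free reading of a regular parametrization: [tau t] is the velocity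
    in Minkowski space. *)
Lemma regular_parametrization S : C1_closed_curve S ->
  exists (g : R -> hplane R) (tau : R -> R * R * R),
    [/\ S = range g, forall t, tau t <> 0,
        forall t, lor (hlift (g t)) (tau t) = 0 &
        forall u t, is_derive t 1 (fun s => lor u (hlift (g s))) (lor u (tau t))].
Proof.
move=> [x [y [dxy _ nz _ ->]]].
exists (fun t => (x t, y t)),
  (fun t => (derive1 x t, derive1 y t,
     (x t * derive1 x t + y t * derive1 y t) / (hlift (x t, y t)).2)).
split=> //.
- by move=> t [e1 e2 _]; apply: (nz t); rewrite e1 e2.
- move=> t; have := hlift_gt0 (x t, y t); rewrite /lor /=.
  by move: (Num.sqrt _) => c c0; field; rewrite gt_eqF.
- move=> u t; have [dx dy] := dxy t.
  have xt : is_derive t 1 x (derive1 x t) by rewrite derive1E; exact: derivableP.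
  have yt : is_derive t 1 y (derive1 y t) by rewrite derive1E; exact: derivableP.
  have zt := is_derive_hlift2 xt yt.
  rewrite /lor /=.
  have -> : (fun s => u.1.1 * x s + u.1.2 * y s - u.2 * (hlift (x s, y s)).2) =
    u.1.1 *: x + u.1.2 *: y - u.2 *: (fun s => (hlift (x s, y s)).2) by [].
  have h := is_deriveB (is_deriveD (is_deriveZ u.1.1 xt) (is_deriveZ u.1.2 yt))
    (is_deriveZ u.2 zt).
  exact: (is_derive_eq h).
Qed.

Lemma extremum_derive (f : R -> R) t d :
  (forall s, derivable f s 1) -> is_derive t 1 f d ->
  (forall s, f s <= f t) -> d = 0.
Proof.
move=> df ft fmax.
have : is_derive t 1 f 0.
  apply: (@derive1_at_max _ f (t - 1) (t + 1)) => //; first by lra.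
  by rewrite in_itv /=; apply/andP; split; lra.
by move=> f0; rewrite -(@derive_val _ _ _ _ _ _ _ ft) derive_val.
Qed.

End Curve.

(** * Projections and widths *)

Section Projection.
Variables (R : realType) (K : set (hplane R)).
Implicit Types (n e : R * R * R) (p q x z a b : hplane R).

(** The projection consists of the feet of the points of [K], and the point
    with foot [x] at signed distance [d] is [cosh d *: x + sinh d *: n]. *)
Lemma projectionP n x : lor n n = 1 -> projection (hline n) K x <->
  hline n x /\ exists z s t, [/\ K z, 0 < s & hlift z = s *: hlift x + t *: n].
Proof.
move=> nn; split=> [[nx [N [[pN Nx] [z [Kz Nz]]]]]|[nx [z [s [t [Kz s0 ez]]]]]].
  split=> //; have [p [v1 [v2 [F eN en]]]] := perpendicularP pN.
  have := hline_eq (frameC F) nn (esym en).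
  have [[_ v11] [_ v22] v12] := F.
  rewrite eN /hline /= in Nx Nz.
  have [v nv] := frame_at nn nx; have [[xv _] [xn _] vn] := nv.
  move=> env; have v2n : lor v2 n = 0.
    by case: env => ->; rewrite ?lorNr (lorC v2) v12 ?oppr0.
  have F2 : frame x v2 n by split=> //; split=> //; rewrite lorC.
  exists z, (- lor (hlift z) (hlift x)), (lor (hlift z) n); split=> //.
    by have := lor_hlift_lt0 z x; lra.
  by rewrite {1}(frame_expand (hlift z) F2) (lorC (hlift z) v2) Nz scale0r addr0.
split=> //; have [v F] := frame_at nn nx; have [[xv vv] [xn _] vn] := F.
exists (hline v); split; last first.
  by exists z; split=> //; rewrite /hline /= ez !lorE (lorC v) xv vn; ring.
split; last by rewrite /hline /= lorC.
exact: perpendicular_hline (frameC F).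
Qed.

Lemma foot n z : lor n n = 1 -> exists x s t,
  [/\ hline n x, 0 < s & hlift z = s *: hlift x + t *: n].
Proof.
move=> nn; pose t := lor (hlift z) n; pose s := Num.sqrt (1 + t ^+ 2).
have s0 : 0 < s by exact: sqrt1D_gt0.
have s2 : s ^+ 2 = 1 + t ^+ 2 by exact: sqr_sqrt1D.
have sN : s != 0 by rewrite gt_eqF.
pose u := s^-1 *: (hlift z - t *: n).
have nz : lor n (hlift z) = t by rewrite lorC.
have uh : hlift u.1 = u.
  apply: (@future_hlift _ _ z); rewrite /u -scaleNr !lorE !lor_hlift nz -/t ?nn.
    rewrite [LHS](_ : _ = - (s^-1 ^+ 2 * (1 + t ^+ 2))); last by ring.
    by rewrite -s2 exprVn mulVf // expf_neq0.
  have h : 0 < s^-1 by rewrite invr_gt0.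
  by have := sqr_ge0 t; nra.
exists u.1, s, t; split=> //.
  by rewrite /hline /= uh /u -scaleNr !lorE nz nn; ring.
by rewrite uh scalerA divff // scale1r subrK.
Qed.

(** The foot of every point of the body lies on the segment, hence on the side
    of [e] where [a] is. *)
Lemma projection_end n a b : lor n n = 1 ->
  projection (hline n) K = segment a b ->
  exists e, frame b e n /\ forall z, K z -> lor e (hlift z) <= 0.
Proof.
move=> nn eP.
have [nb _] : projection (hline n) K b by rewrite eP; exact: segment_r.
have [e [F ea]] : exists e, frame b e n /\ lor e (hlift a) <= 0.
  have [e F] := frame_at nn nb; case: (lerP (lor e (hlift a)) 0) => h.
    by exists e.
  by exists (- e); split; [exact: frameN | rewrite lorNl; lra].
exists e; split=> // z Kz; have [[be _] _ en] := F.
have [x [s [t [nx s0 ez]]]] := foot z nn.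
have : projection (hline n) K x.
  by apply/(projectionP _ nn); split=> //; exists z, s, t.
rewrite eP => -[s' [t' [s'0 t'0 ex]]].
rewrite ez ex !lorE en (lorC e (hlift b)) be.
have := mulr_ge0 (ltW s0) s'0; nra.
Qed.

(** Here [t1] and [t2] are the hyperbolic sines of the signed distances to the
    line, [s1] and [s2] their cosines, and
    [s1 * s2 * W - t1 * t2 = s1 * s2 * (W - 1) + (s1 * s2 - t1 * t2)], where the
    last term is at least 1: so the bound [W] forces [s1 = s2 = 1]. *)
Lemma cosh_dist_feet n x y z1 z2 s1 s2 t1 t2 : lor n n = 1 ->
  hline n x -> hline n y -> 0 < s1 -> 0 < s2 ->
  hlift z1 = s1 *: hlift x + t1 *: n -> hlift z2 = s2 *: hlift y + t2 *: n ->
  1 < cosh_dist x y -> cosh_dist z1 z2 <= cosh_dist x y -> x = z1 /\ y = z2.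
Proof.
move=> nn nx ny s10 s20 e1 e2; rewrite /hline /= in nx ny.
have xn : lor (hlift x) n = 0 by rewrite lorC.
have yn : lor (hlift y) n = 0 by rewrite lorC.
have := lor_hlift z1; rewrite e1 !lorE lor_hlift nn nx xn => h1.
have := lor_hlift z2; rewrite e2 !lorE lor_hlift nn ny yn => h2.
have -> : cosh_dist z1 z2 = s1 * s2 * cosh_dist x y - t1 * t2.
  by rewrite /cosh_dist e1 e2 !lorE nn ny xn; ring.
move: (cosh_dist x y) => W W1 h.
have s11 : 1 <= s1 by nra.
have s21 : 1 <= s2 by nra.
have p1 : 1 <= s1 * s2 by nra.
have id : (s1 * s2) ^+ 2 = (1 + t1 * t2) ^+ 2 + (t1 - t2) ^+ 2.
  have -> : (s1 * s2) ^+ 2 = (s1 * s1) * (s2 * s2) by ring.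
  have -> : s1 * s1 = 1 + t1 * t1 by lra.
  have -> : s2 * s2 = 1 + t2 * t2 by lra.
  ring.
have g : 1 <= s1 * s2 - t1 * t2 by have := sqr_ge0 (t1 - t2); nra.
have p2 : s1 * s2 = 1 by nra.
have s1E : s1 = 1 by nra.
have s2E : s2 = 1 by nra.
have t1E : t1 = 0 by nra.
have t2E : t2 = 0 by nra.
by split; apply: hlift_inj; rewrite ?e1 ?e2 ?s1E ?s2E ?t1E ?t2E scale1r scale0r addr0.
Qed.

End Projection.

(** * Bodies of constant width *)

Section ConstantWidth.
Variables (R : realType) (O : hplane R) (K : set (hplane R)) (w : R).
Hypotheses (K_convex : convex_body K) (K_width : constant_width K w).
Hypotheses (K_O : interior K O) (K_C1 : C1_closed_curve (bdry K)).
Implicit Types (n e : R * R * R) (c p q x y z a b : hplane R).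

Let KO : K O. Proof. exact: interior_subset. Qed.

(** The velocity of the boundary curve at [q] is orthogonal to [c], because the
    distance to [c] is extremal there, and to [v], because the body is on one side
    of the supporting geodesic.  It is not zero, so [c] lies in the plane of [q]
    and [v]. *)
Lemma farthest_normal c q G N : K c -> K q -> c <> q ->
  (forall z, K z -> cosh_dist c z <= cosh_dist c q) ->
  supporting K G -> G q -> normal_at G q N ->
  exists v n, [/\ frame q v n, G = hline v /\ N = hline n,
    lor n (hlift c) = 0, lor v (hlift c) < 0 &
    forall z, K z -> lor v (hlift z) <= 0].
Proof.
move=> Kc Kq cq qmax sG Gq [pN Nq].
have bq := farthest_bdry K_convex Kq cq qmax.
have [p [v1 [n [F eN eG]]]] := perpendicularP pN.
have [[_ v11] [_ nn] v1n] := F.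
rewrite eN /hline /= in Nq; rewrite eG in sG; rewrite eG /hline /= in Gq.
have Fq : frame q v1 n by split=> //; split=> //; rewrite lorC.
have [v [Fv ev side]] : exists v, [/\ frame q v n, hline v1 = hline v &
    forall z, K z -> lor v (hlift z) <= 0].
  have [h|h] := supporting_one_sided K_convex sG v11.
    by exists v1.
  by exists (- v1); split=> //; [exact: frameN | rewrite hlineN].
have [[qv _] [qn _] _] := Fv; rewrite lorC in qv.
have [g [tau [eb tau0 gtau dg]]] := regular_parametrization K_C1.
have [t _ et] : range g q by rewrite -eb.
have gK s : K (g s).
  have /(bdryP K_convex)[] // : bdry K (g s).
  by rewrite eb; exists s.
have crit u : (forall s, lor u (hlift (g s)) <= lor u (hlift (g t))) ->
    lor u (tau t) = 0.
  by move=> h; apply: (@extremum_derive _ (fun s => lor u (hlift (g s))) t) => //.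
have cN : lor (- hlift c) (tau t) = 0.
  by apply: crit => s; rewrite !lorNl et; exact: qmax.
have vN : lor v (tau t) = 0.
  by apply: crit => s; rewrite et qv; exact: side.
have qN := gtau t; rewrite et in qN.
have tn : lor (tau t) n <> 0.
  move=> tn; apply: (tau0 t); rewrite (frame_expand (tau t) Fv).
  by rewrite (lorC _ (hlift q)) (lorC _ v) qN vN tn oppr0 !scale0r !addr0.
have nc : lor n (hlift c) = 0.
  have := frame_lor (hlift c) (tau t) Fv.
  rewrite (lorC (tau t) (hlift q)) (lorC (tau t) v) qN vN !mulr0 !add0r.
  move: cN; rewrite lorNl => /eqP; rewrite oppr_eq0 => /eqP -> /esym/eqP.
  by rewrite mulf_eq0 lorC => /orP[/eqP //|/eqP].
exists v, n; split=> //; first by rewrite eG.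
rewrite lt_neqAle side // andbT; apply/eqP => vc; apply: cq; apply: cosh_dist_eq1.
have := frame_lor (hlift c) (hlift c) Fv.
rewrite lor_hlift (lorC _ v) (lorC _ n) vc nc.
have := cosh_dist_ge1 c q; rewrite /cosh_dist.
by move=> h1 h2; nra.
Qed.

(** The frames at [q] and [y] describe the two supporting geodesics of the width
    at [q]: their outer normals are [v] and [e], and [n] is the normal of their
    common perpendicular, which passes through [c].  The numbers [a] and [b] are
    the hyperbolic cosine and sine of the width. *)
Lemma width_at_farthest c q : K c -> K q -> c <> q ->
  (forall z, K z -> cosh_dist c z <= cosh_dist c q) ->
  exists v n y e (a b : R),
    [/\ frame q v n, frame y e n, lor n (hlift c) = 0 & lor v (hlift c) < 0] /\
    [/\ hlift y = a *: hlift q + (- b) *: v, e = b *: hlift q + (- a) *: v,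
        1 < a, 0 < b & arcosh a = w] /\
    [/\ a ^+ 2 = 1 + b ^+ 2,
        forall z, K z -> lor v (hlift z) <= 0,
        forall z, K z -> lor e (hlift z) <= 0 &
        exists2 z, K z & lor e (hlift z) = 0].
Proof.
move=> Kc Kq cq qmax; have bq := farthest_bdry K_convex Kq cq qmax.
have [G1 [N [G2 [y [[sG1 G1q] nN [sG2 G21 pG2] [Ny G2y] dw]]]]] := K_width bq.
have [v [n [F [eG1 eN] nc vc side]]] := farthest_normal Kc Kq cq qmax sG1 G1q nN.
have [[qv vv] [qn nn] vn] := F.
have [p [v1 [v2 [F' eG2 eN']]]] := perpendicularP pG2.
have [[_ v11] [_ v22] v12] := F'.
have v2n : lor v2 n = 0.
  have [|e|e] := @hline_eq _ q v n v1 F v11; first by rewrite -eN -eN'.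
    by rewrite -e lorC.
  by rewrite -(opprK n) -e lorNr lorC v12 oppr0.
rewrite eG2 in sG2.
have [e [e2 ee en eside]] : exists e, [/\ hline v2 = hline e, lor e e = 1,
    lor e n = 0 & forall z, K z -> lor e (hlift z) <= 0].
  have [h|h] := supporting_one_sided K_convex sG2 v22.
    by exists v2.
  exists (- v2); split=> //; first by rewrite hlineN.
    by rewrite lorNl lorNr opprK.
  by rewrite lorNl v2n oppr0.
rewrite eG2 e2 in G2y G21; rewrite e2 in sG2.
have [z0 [ez0 bz0]] := supporting_touches sG2.
have [Kz0 _] := (bdryP K_convex z0).1 bz0.
rewrite eN in Ny; have ey := hline_hexp F Ny.
set s := lor (hlift y) v in ey.
have ly := hlift_hexp s (conj qv vv); rewrite -ey in ly.
have A0 := sqrt1D_gt0 s; have A2 := sqr_sqrt1D s.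
move: ly A0 A2; set A := Num.sqrt _ => ly A0 A2.
rewrite /hline /= in G2y ez0.
pose P := lor e (hlift q); pose Q := lor e v.
have PQ : Q ^+ 2 = 1 + P ^+ 2.
  by have := frame_lor e e F; rewrite ee en -/P -/Q !expr2; lra.
have PQy : A * P + s * Q = 0 by rewrite -G2y ly !lorE.
have P0 : P <= 0 by exact: eside.
have touch : - P * lor (hlift z0) (hlift q) + Q * lor (hlift z0) v = 0.
  by rewrite -ez0 (frame_lor e (hlift z0) F) en mul0r addr0.
have zq := lor_hlift_lt0 z0 q.
have zv : lor (hlift z0) v <= 0 by rewrite lorC; exact: side.
(* The vector [e] is orthogonal to [n] and to [y], hence is [s *: q + A *: v] up
   to sign; of the two signs, one contradicts that the line touches [K], and
   [s = 0] would give the supporting geodesic at [q] again. *)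
have eE := frame_expand e F; rewrite en scale0r addr0 -/P -/Q in eE.
have Pneq : P <> 0.
  move=> P_0; apply: G21; rewrite eG1 eE P_0 oppr0 scale0r add0r.
  have /eqP : Q ^+ 2 = 1 by rewrite PQ P_0 expr0n addr0.
  by rewrite sqrf_eq1 => /orP[] /eqP ->; rewrite ?scale1r // scaleN1r hlineN.
have Pl : P < 0 by rewrite lt_neqAle P0 andbT; apply/eqP.
clear cq G21; have Q0 : Q < 0.
  by rewrite ltNge; apply/negP => Q0; nra.
have s0 : s < 0 by nra.
have QA : Q = - A.
  have : (Q + A) * (Q - A) = 0.
    have h : (A * P) ^+ 2 = (s * Q) ^+ 2.
      have -> : A * P = - (s * Q) by lra.
      by rewrite sqrrN.
    have h2 : Q ^+ 2 = A ^+ 2.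
      by move: h; rewrite !exprMn A2 PQ; lra.
    by rewrite mulrC -subr_sqr h2 subrr.
  by move/eqP; rewrite mulf_eq0 => /orP[/eqP|/eqP]; lra.
have Ps : P = s by nra.
exists v, n, y, e, A, (- s); split; last split.
- split=> //; split=> //; first by split=> //; rewrite lorC.
  by split=> //; rewrite lorC.
- split; rewrite ?opprK //.
  + by rewrite {1}eE Ps QA.
  + by nra.
  + by lra.
  + rewrite -dw /hdist ly !lorE lor_hlift qv; congr arcosh; ring.
- split=> //; first by rewrite sqrrN.
  by exists z0.
Qed.

Lemma bdry_nonempty : exists z, bdry K z /\ O <> z.
Proof.
have [g [_ [eb _ _ _]]] := regular_parametrization K_C1.
have b : bdry K (g 0) by rewrite eb; exists 0.
by exists (g 0); split=> // e; apply: (interior_not_bdry K_convex K_O); rewrite e.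
Qed.

(** Let [c] and [q] be the endpoints of a diameter.  The supporting geodesic
    opposite to [q] does not separate [c] from [q], so that the width at [q] is
    at least the diameter; and it touches the body at a point whose distance to
    [q] is at least the width. *)
Lemma width_diameter : exists W,
  [/\ 1 < W, arcosh W = w & forall z1 z2, K z1 -> K z2 -> cosh_dist z1 z2 <= W].
Proof.
have [c [q [Kc Kq dmax]]] := diameter K_convex KO.
have cq : c <> q.
  move=> e; have [z [/(bdryP K_convex)[Kz _] Oz]] := bdry_nonempty.
  apply: Oz; apply: cosh_dist_eq1; have := dmax _ _ KO Kz; rewrite e cosh_distpp.
  by have := cosh_dist_ge1 O z; lra.
have [v [n [y [e [a [b [[F _ nc vc] [[_ eE a1 b0 aw]]]]]]]]] :=
  width_at_farthest Kc Kq cq (fun z => dmax c z Kc).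
move=> [ab side eside [z0 Kz0 ez0]].
exists a; split=> // z1 z2 Kz1 Kz2; apply: le_trans (dmax _ _ Kz1 Kz2) _.
have c1 := cosh_dist_ge1 c q.
have cc := frame_lor (hlift c) (hlift c) F.
rewrite lor_hlift (lorC (hlift c) n) nc in cc.
have := eside c Kc; rewrite eE !lorE (lorC _ (hlift c)).
rewrite (lorC v) in vc *; move: cc c1; rewrite /cosh_dist.
move: (lor (hlift c) (hlift q)) (lor (hlift c) v) vc => C S S0 cc C1 h.
have h' : a * - S <= b * - C by lra.
have sq : a ^+ 2 * S ^+ 2 <= b ^+ 2 * C ^+ 2.
  rewrite -(sqrrN S) -(sqrrN C) -!exprMn.
  by rewrite ler_pXn2r // nnegrE; nra.
have : C ^+ 2 <= a ^+ 2.
  have -> : C ^+ 2 = 1 + S ^+ 2 by rewrite !expr2; lra.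
  have eC : C ^+ 2 = 1 + S ^+ 2 by rewrite !expr2; lra.
  by rewrite eC in sq; nra.
by rewrite -sqrrN ler_pXn2r // nnegrE; lra.
Qed.

(** At a point farthest from the origin, the normal passes through the origin,
    and the feet on it of the points of the body are exactly those between the
    two supporting geodesics that define the width. *)
Lemma projection_length l : (forall G, geodesic G -> G O ->
    segment_of_length (projection G K) l) -> l = w.
Proof.
move=> K_proj; have [q [Kq qmax]] := cosh_dist_max K_convex O KO.
have Oq : O <> q.
  move=> e; have [z [/(bdryP K_convex)[Kz _] Oz]] := bdry_nonempty.
  apply: Oz; apply: cosh_dist_eq1; have := qmax _ Kz; rewrite -e cosh_distpp.
  by have := cosh_dist_ge1 O z; lra.
have [v [n [y [e [a [b [[F Fy nO _] [[ey eE a1 b0 aw]]]]]]]]] :=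
  width_at_farthest KO Kq Oq qmax.
move=> [ab side eside [z0 Kz0 ez0]].
have [[qv vv] [qn nn] _] := F.
have [x1 [x2 [eP dl]]] := K_proj _ (geodesic_hline F) nO.
have Pq : projection (hline n) K q.
  apply/(projectionP _ _ nn); split; first exact: frame_mem F.
  by exists q, 1, 0; rewrite scale1r scale0r addr0; split=> //; lra.
have Py : projection (hline n) K y.
  apply/(projectionP _ _ nn); split; first exact: frame_mem Fy.
  exists z0, (- lor (hlift z0) (hlift y)), (lor (hlift z0) n); split=> //.
    by have := lor_hlift_lt0 z0 y; lra.
  by rewrite {1}(frame_expand (hlift z0) Fy) (lorC _ e) ez0 scale0r addr0.
have sub x : projection (hline n) K x -> segment q y x.
  move=> /(projectionP _ _ nn)[nx [z [s [t [Kz s0 ez]]]]].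
  have vx : lor v (hlift x) <= 0.
    have := side z Kz; rewrite ez !lorE; have [_ _ ->] := F.
    by rewrite mulr0 addr0 pmulr_rle0.
  have ex : lor e (hlift x) <= 0.
    have := eside z Kz; rewrite ez !lorE; have [_ _ ->] := Fy.
    by rewrite mulr0 addr0 pmulr_rle0.
  rewrite eE !lorE in ex; have bN : b != 0 by rewrite gt_eqF.
  exists (- lor (hlift x) (hlift q) + a * lor v (hlift x) / b),
    (- lor v (hlift x) / b).
  split.
  - have -> : - lor (hlift x) (hlift q) + a * lor v (hlift x) / b =
      - (b * lor (hlift q) (hlift x) + - a * lor v (hlift x)) / b.
      by rewrite (lorC (hlift x)); field.
    by apply: divr_ge0; [rewrite oppr_ge0; exact: ex | exact: ltW].
  - by rewrite divr_ge0 ?oppr_ge0 // ltW.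
  rewrite ey {1}(frame_expand (hlift x) F) (lorC _ n) nx scale0r addr0.
  rewrite !scalerDr !scalerA addrA -scalerDl (lorC (hlift x) v).
  by congr (_ *: _ + _ *: _); field.
have [P1 P2] : projection (hline n) K x1 /\ projection (hline n) K x2.
  by rewrite eP; split; [exact: segment_l | exact: segment_r].
have d1 : cosh_dist x1 x2 <= cosh_dist q y by apply: segment_cosh_dist_le; exact: sub.
have d2 : cosh_dist q y <= cosh_dist x1 x2.
  by apply: segment_cosh_dist_le; rewrite -eP.
have qy : cosh_dist q y = a.
  by rewrite /cosh_dist ey !lorE lor_hlift qv; ring.
by rewrite -dl -aw /hdist -/(cosh_dist x1 x2) -qy; congr arcosh; apply/eqP;
  rewrite eq_le d1 d2.
Qed.

(** Otherwise [q] would lie between the origin, which is an interior point, and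
    one of the endpoints, so that it would be an interior point too. *)
Lemma bdry_segment_endpoint a b q : K a -> K b -> bdry K q ->
  segment a b O -> segment a b q -> q = a \/ q = b.
Proof.
move=> Ka Kb bq [s [t [s0 t0 eO]]] [s' [t' [s'0 t'0 eq]]].
have niq : ~ interior K q by move=> /interior_not_bdry; exact.
have unit_scale (r : R) p z : 0 <= r -> hlift z = r *: hlift p -> z = p.
  move=> r0 ez; have := lor_hlift z; rewrite ez !lorE lor_hlift => h.
  by apply: hlift_inj; rewrite ez (_ : r = 1) ?scale1r //; nra.
have inner c d (x y x' y' : R) : K d -> 0 < x -> 0 <= y -> 0 < x' ->
    hlift O = x *: hlift c + y *: hlift d ->
    hlift q = x' *: hlift c + y' *: hlift d -> x' * y <= x * y' -> False.
  move=> Kd x0 y0 x'0 eO' eq' h; apply: niq.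
  have xN : x != 0 by rewrite gt_eqF.
  apply: (interior_convex K_convex K_O Kd (s := x' / x)
    (t := (x * y' - x' * y) / x)).
  - exact: divr_gt0.
  - by rewrite divr_ge0 ?(ltW x0) // subr_ge0.
  rewrite eq' eO' scalerDr !scalerA -addrA -scalerDl.
  by congr (_ *: _ + _ *: _); field.
have [s'E|s'N] := eqVneq s' 0.
  by right; apply: (unit_scale t') => //; rewrite eq s'E scale0r add0r.
have [t'E|t'N] := eqVneq t' 0.
  by left; apply: (unit_scale s') => //; rewrite eq t'E scale0r addr0.
have s'p : 0 < s' by rewrite lt_def s'N.
have t'p : 0 < t' by rewrite lt_def t'N.
have st : 0 < s \/ 0 < t.
  case: (ltP 0 s) => h; [by left|right].
  rewrite lt_def t0 andbT; apply/eqP => t00.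
  have := lor_hlift O; rewrite eO t00 (_ : s = 0) ?scale0r ?addr0 ?lor0l; lra.
exfalso; case: (lerP (s' * t) (s * t')) => h.
  have s1 : 0 < s by nra.
  exact: (inner a b s t s' t').
have t1 : 0 < t by nra.
apply: (inner b a t s t' s') => //.
- by rewrite addrC.
- by rewrite addrC.
- by rewrite mulrC (mulrC t) ltW.
Qed.

(** The projection on the geodesic from the origin to [q] is as long as the
    diameter, and projecting shortens distances: so the endpoints of the
    projection belong to the body, and [q] is one of them. *)
Lemma central_normal q l : (forall G, geodesic G -> G O ->
    segment_of_length (projection G K) l) -> bdry K q ->
  exists e n, [/\ frame q e n, lor n (hlift O) = 0 &
    forall z, K z -> lor e (hlift z) <= 0].
Proof.
move=> K_proj bq; have [Kq niq] := (bdryP K_convex q).1 bq.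
have Oq : O <> q by move=> e; apply: niq; rewrite -e.
have [v [n [s [F s0 eq]]]] := geodesic_through Oq.
have [_ [_ nn] _] := F.
have nO := frame_mem F; have nq := hexp_hline s F; rewrite -eq in nq.
have [a [b [eP dl]]] := K_proj _ (geodesic_hline F) nO.
have [W [W1 Ww dW]] := width_diameter.
have abW : cosh_dist a b = W.
  apply: arcosh_inj; [exact: cosh_dist_ge1 | exact: ltW |].
  by rewrite Ww -(projection_length K_proj) -dl.
have Pa : projection (hline n) K a by rewrite eP; exact: segment_l.
have Pb : projection (hline n) K b by rewrite eP; exact: segment_r.
have [na [z1 [s1 [t1 [Kz1 s10 e1]]]]] := (projectionP K a nn).1 Pa.
have [nb [z2 [s2 [t2 [Kz2 s20 e2]]]]] := (projectionP K b nn).1 Pb.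
have [] := cosh_dist_feet nn na nb s10 s20 e1 e2.
- by rewrite abW.
- by rewrite abW; exact: dW.
move=> az1 bz2; rewrite -az1 in Kz1; rewrite -bz2 in Kz2.
have own x : K x -> hline n x -> segment a b x.
  move=> Kx nx; rewrite -eP; apply/(projectionP _ _ nn); split=> //.
  by exists x, 1, 0; rewrite scale1r scale0r addr0; split=> //; lra.
have [qa|qb] := bdry_segment_endpoint Kz1 Kz2 bq (own _ KO nO) (own _ Kq nq).
  rewrite segmentC in eP; have [e [Fe he]] := projection_end nn eP.
  by exists e, n; rewrite qa.
have [e [Fe he]] := projection_end nn eP.
by exists e, n; rewrite qb.
Qed.

(** All normals of the boundary curve pass through the origin, so the distance
    to the origin is constant along it. *)
Lemma bdry_equidistant l : (forall G, geodesic G -> G O ->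
    segment_of_length (projection G K) l) ->
  exists r, 1 < r /\ forall z, bdry K z -> cosh_dist O z = r.
Proof.
move=> K_proj.
have [g [tau [eb tau0 gtau dg]]] := regular_parametrization K_C1.
have bg s : bdry K (g s) by rewrite eb; exists s.
have dO (s : R) : is_derive s 1 (fun t => lor (hlift O) (hlift (g t))) 0.
  have [e [n [F nO side]]] := central_normal K_proj (bg s).
  have [[qe _] _ _] := F.
  have eN : lor e (tau s) = 0.
    apply: (@extremum_derive _ (fun t => lor e (hlift (g t))) s) => // t.
    rewrite [leRHS]lorC qe; apply: side.
    by have [] := (bdryP K_convex (g t)).1 (bg t).
  have := dg (hlift O) s.
  by rewrite (frame_lor (hlift O) (tau s) F) (lorC (tau s)) gtau
    (lorC (tau s) e) eN (lorC (hlift O) n) nO mul0r !mulr0 !addr0.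
exists (cosh_dist O (g 0)); split.
  apply: cosh_dist_gt1 => e; apply: (interior_not_bdry K_convex K_O).
  by rewrite e; exact: bg.
move=> z; rewrite eb => -[t _ <-].
by rewrite /cosh_dist (is_derive_0_is_cst t 0 dO).
Qed.

Lemma equidistant_disc r : 1 < r ->
  (forall z, bdry K z -> cosh_dist O z = r) -> disc K.
Proof.
move=> r1 hr; exists O, (arcosh r); split; first exact: arcosh_gt0.
apply/seteqP; split=> z; rewrite /= /hdist arcosh_le ?cosh_dist_ge1 ?(ltW r1) //
  -/(cosh_dist O z).
  move=> Kz; have [q [Kq qmax]] := cosh_dist_max K_convex O KO.
  apply: le_trans (qmax z Kz) _; rewrite (hr q) //.
  have [x [bx Ox]] := bdry_nonempty; have [Kx _] := (bdryP K_convex x).1 bx.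
  apply: (farthest_bdry K_convex Kq _ qmax) => Oq.
  have := qmax x Kx; rewrite -Oq cosh_distpp (hr x bx); lra.
move=> zr; apply: contrapT => nKz.
have Oz : O <> z by move=> e; apply: nKz; rewrite -e; exact: KO.
have [v [s [Ov s0 ez]]] := direction Oz.
have niz : ~ interior K (hexp O v s).
  by rewrite -ez => /interior_subset.
have [|t [t0 ts bt]] := crossing K_convex (@continuous_hexp R O v) (ltW s0) _ niz.
  by rewrite hexp0.
apply: nKz; have [Kt _] := (bdryP K_convex _).1 bt.
suff -> : z = hexp O v t by [].
rewrite ez; congr hexp.
have := hr _ bt; move: zr; rewrite ez !(cosh_dist_hexp _ Ov).
have := sqr_sqrt1D s; have := sqrt1D_gt0 s.
have := sqr_sqrt1D t; have := sqrt1D_gt0 t.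
by clear ez Oz; move=> h1 h2 h3 h4 h5 h6; nra.
Qed.

End ConstantWidth.

Theorem theorem4p4 (R : realType) (O : hplane R) (K : set (hplane R)) (w : R)
    (K_convex : convex_body K)
    (K_width : constant_width K w)
    (K_O : interior K O)
    (K_C1 : C1_closed_curve (bdry K))
    (K_proj : exists l : R, forall G : set (hplane R),
       geodesic G -> G O -> segment_of_length (projection G K) l) :
  disc K.
Proof.
have [l K_proj_l] := K_proj.
have [r [r1 hr]] := bdry_equidistant K_convex K_width K_O K_C1 K_proj_l.
exact: (equidistant_disc K_convex K_O K_C1 r1 hr).
Qed.
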